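(* Let $B\in\mathcal B$ be a one-sided banded matrix which can be decomposed as $B=B_-+B_+$ such that (1) $B_-$ is strictly lower triangular; (2) $B_+$ is upper triangular and banded, that is, there exists $b\in\mathbb N$ such that $(B_+)_{j,j+\ell}=0$ for $\ell<0$ and for $\ell>b$; (3) $[B_-,B_+]Q_s=(B_-B_+-B_+B_-)Q_s=0$ for some $s\in\mathbb N$. Then, for every $m\ge3$, $C^{(n)}_m(B)\to0$ as $n\to\infty$.
   Context: $\mathcal B$ is the space of infinite matrices $B=(B_{i,j})_{i,j=1}^\infty$ for which there exists $b>0$ (depending on $B$) such that $B_{ij}=0$ for $j>i+b$; it is closed under addition and matrix multiplication. $P_n$ is the projection onto the first $n$ coordinates, $P_n(x_1,x_2,\dots)^T=(x_1,\dots,x_n,0,0,\dots)^T$, and $Q_n=I-P_n$. For $B\in\mathcal B$ and $m\ge1$, $$C^{(n)}_m(B)=m!\sum_{j=1}^m\frac{(-1)^{j+1}}j\sum_{\substack{l_1+\dots+l_j=m\\ l_i\ge1}}\frac{\operatorname{Tr}\big(P_nB^{l_1}P_nB^{l_2}P_n\cdots P_nB^{l_j}P_n\big)}{l_1!\cdots l_j!}.$$ *)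

(* Defs.v *)
From HB Require Import structures.
From mathcomp Require Import all_boot all_order all_algebra.
From mathcomp Require Import all_classical all_reals all_analysis.

Set Implicit Arguments.
Unset Strict Implicit.
Unset Printing Implicit Defensive.

Import Order.TTheory GRing.Theory Num.Theory.
Import numFieldNormedType.Exports.

Local Open Scope classical_set_scope.
Local Open Scope ring_scope.

(* Coordinates are numbered from 0: [B i j] is the entry B_{i+1,j+1}. Sums and
   differences of infinite matrices are the pointwise ones on functions. *)
Definition imatrix (K : numFieldType) : Type := nat -> nat -> K.

Section InfiniteMatrices.
Variable K : numFieldType.
Implicit Types A B : imatrix K.

Definition one_sided_banded B : Prop :=
  exists2 b : nat, (0 < b)%N & forall i j : nat, (i + b < j)%N -> B i j = 0.

(* [\sum_(k \in [set: nat])] is the sum of a finitely supported family (and 0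
   if the support is infinite). The rows of a one-sided banded matrix are
   finitely supported, so this is the usual product whenever [A] is one. *)
Definition imulmx A B : imatrix K :=
  fun i j => \sum_(k \in [set: nat]) A i k * B k j.

Definition iidmx : imatrix K := fun i j => (i == j)%:R.

Definition iexpmx B (l : nat) : imatrix K := iter l (imulmx B) iidmx.

Definition projP (n : nat) : imatrix K := fun i j => ((i == j) && (i < n)%N)%:R.

Definition projQ (n : nat) : imatrix K := iidmx - projP n.

(* Only applied to matrices of the form P_n A P_n, whose diagonal is finitely
   supported. *)
Definition itrace A : K := \sum_(i \in [set: nat]) A i i.

(* P_n B^{l_1} P_n B^{l_2} P_n ... P_n B^{l_j} P_n for l = (l_1, ..., l_j) *)
Definition compressed_product (n : nat) B (l : seq nat) : imatrix K :=
  foldr (fun li A => imulmx (projP n) (imulmx (iexpmx B li) A)) (projP n) l.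

(* C^{(n)}_m(B). The bound [l_i <= m] built into ['I_m.+1] is implied by
   l_1 + ... + l_j = m. *)
Definition cumulant (m n : nat) B : K :=
  m`!%:R * \sum_(1 <= j < m.+1) ((-1) ^+ j.+1 / j%:R *
    \sum_(l : j.-tuple 'I_m.+1 |
          (\sum_(i < j) tnth l i == m)%N && [forall i, (1 <= tnth l i)%N])
      itrace (compressed_product n B (map val l)) /
        \prod_(i < j) (tnth l i)`!%:R).

Definition strictly_lower_triangular A : Prop :=
  forall i j : nat, (i <= j)%N -> A i j = 0.

Definition upper_triangular_banded A : Prop :=
  exists b : nat, forall i j : nat, (j < i)%N || (i + b < j)%N -> A i j = 0.

End InfiniteMatrices.

(* Main.v *)
Require Import Defs.
From HB Require Import structures.
From mathcomp Require Import all_boot all_order all_algebra.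
From mathcomp Require Import all_classical all_reals all_analysis.

Set Implicit Arguments.
Unset Strict Implicit.
Unset Printing Implicit Defensive.

Import Order.TTheory GRing.Theory Num.Theory.
Import numFieldNormedType.Exports.

Local Open Scope classical_set_scope.
Local Open Scope ring_scope.

(** Write A, C for the lower and upper parts and P for P_n. The cumulant
    C_m^(n)(A + C) is m! times the coefficient of t^m in
    tr log (P exp(t (A + C)) P), the logarithm being taken in the corner
    P _ P, where the compressed exponential is P plus a series X without
    constant term. All series are truncated after t^m, so X is nilpotent and
    every identity below is exact.

    With theta = t d/dt and G = P exp(t (A + C)) P, m times the coefficient of
    t^m in tr log G is the coefficient of t^m in tr (H theta(G)), where H is
    the inverse of G in the corner ([ttr_log]). To invert G, put
    W = exp(t (A + C)) exp(- t C) and U = exp(t C). Since C is upper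
    triangular, U P = P U P. Since C A - A C has finitely many nonzero columns,
    W exp(- t A) differs from 1 by a series whose coefficients have finitely
    many nonzero columns. As A is lower triangular, this gives P W = P W P and
    P W^-1 = P W^-1 P once n is large ([absorb_EU']). Hence
    G = (P W P) (P U P) and H = U^-1 P W^-1.

    Cyclicity of the trace now reduces tr (H theta(G)) to
    tr (W^-1 theta(W) P) + tr (t C P), and W^-1 theta(W) = t V with
    V = U A U^-1 ([teuler_EU']). Finally theta(V) = t U (C A - A C) U^-1, whose
    trace is t tr (C A - A C), so V - A has zero trace in degrees at least 2
    ([ttr_conjA]). The coefficient of t^m is therefore 0 for m at least 3, and
    the cumulant is exactly 0 for all large n.

    Traces of infinite matrices are taken on the two-sided ideal of matrices
    with finitely many nonzero columns, where tr (X B) = tr (B X) for every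
    one-sided banded B ([btrC]). *)

(** * Truncated power series over a ring *)

(** The ring R[t]/(t^(M+1)) over a possibly noncommutative ring R, with t
    central. An element is represented by a polynomial of degree at most M. *)
Definition tseries (R : nzRingType) (M : nat) : Type := {poly_M.+1 R}.

HB.instance Definition _ (R : nzRingType) (M : nat) :=
  GRing.Zmodule.on (tseries R M).

(** The truncated series with coefficients [c 0], ..., [c M]. *)
HB.lock Definition tmake (R : nzRingType) (M : nat) (c : nat -> R) : tseries R M :=
  mk_npoly M.+1 c.

(** The product of polynomials, truncated after degree M. *)
HB.lock Definition tmul (R : nzRingType) (M : nat) (f g : tseries R M) :
    tseries R M :=
  npolyp M.+1 ((f : {poly R}) * (g : {poly R})).

(** The constant series [c]. *)
HB.lock Definition tconst (R : nzRingType) (M : nat) (c : R) : tseries R M :=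
  tmake M (fun k => if k == 0%N then c else 0).

(** The indeterminate t; it is 0 when [M = 0]. *)
HB.lock Definition tX (R : nzRingType) (M : nat) : tseries R M :=
  tmake M (fun k => (k == 1%N)%:R).

(** The Euler derivation t d/dt. Unlike d/dt, it is well defined modulo
    t^(M+1). *)
HB.lock Definition teuler (R : nzRingType) (M : nat) (f : tseries R M) :
    tseries R M :=
  tmake M (fun k => (f : {poly R})`_k *+ k).

Arguments tmul {R M}.
Arguments tconst {R}.
Arguments tmake {R}.
Arguments teuler {R M}.

Section TruncatedSeries.
Variables (R : nzRingType) (M : nat).
Local Notation T := (tseries R M).
Implicit Types f g h : T.

(** The coefficient of t^k, which is 0 for [k > M]. *)
Definition tcoef (k : nat) f : R := (f : {poly R})`_k.

Lemma tcoefP f g : (forall k, (k <= M)%N -> tcoef k f = tcoef k g) -> f = g.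
Proof.
move=> fg; apply/npolyP => k.
have [kM|Mk] := leqP k M; first exact: fg.
by rewrite !(@big_coef_npoly _ M.+1).
Qed.

Lemma tcoef_is_additive k : zmod_morphism (tcoef k).
Proof. by move=> f g; rewrite /tcoef /= coefB. Qed.

HB.instance Definition _ k :=
  GRing.isZmodMorphism.Build T R (tcoef k) (tcoef_is_additive k).

Lemma tcoef_gt k f : (M < k)%N -> tcoef k f = 0.
Proof. exact: big_coef_npoly. Qed.


Lemma tcoef_make c k : (k <= M)%N -> tcoef k (tmake M c) = c k.
Proof. by move=> kM; rewrite /tcoef tmake.unlock /= coef_poly ltnS kM. Qed.

Definition tone : T := npolyp M.+1 1.

Lemma tcoef_mul_poly f g k :
  (k <= M)%N -> tcoef k (tmul f g) = ((f : {poly R}) * (g : {poly R}))`_k.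
Proof. by move=> kM; rewrite /tcoef tmul.unlock coef_npolyp ltnS kM. Qed.

Lemma tmulA : associative (@tmul R M).
Proof.
move=> f g h; apply: tcoefP => k kM; rewrite !tcoef_mul_poly //.
transitivity (polyn f * (polyn g * polyn h))`_k.
  rewrite !coefM; apply: eq_bigr => i _; congr (_ * _).
  by rewrite -/(tcoef _ _) tcoef_mul_poly // (leq_trans (leq_subr _ _)).
rewrite mulrA !coefM; apply: eq_bigr => i _; congr (_ * _).
by rewrite -[RHS]/(tcoef _ _) tcoef_mul_poly // (leq_trans _ kM) // -ltnS.
Qed.

Lemma tmul1f : left_id tone (@tmul R M).
Proof.
move=> f; apply: tcoefP => k kM; rewrite tcoef_mul_poly //.
by rewrite npolypK ?mul1r // size_poly1.
Qed.

Lemma tmulf1 : right_id tone (@tmul R M).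
Proof.
move=> f; apply: tcoefP => k kM; rewrite tcoef_mul_poly //.
by rewrite npolypK ?mulr1 // size_poly1.
Qed.

Lemma tmulDl : left_distributive (@tmul R M) +%R.
Proof.
move=> f g h; apply: tcoefP => k kM; rewrite raddfD /= !tcoef_mul_poly //.
by rewrite /= mulrDl coefD.
Qed.

Lemma tmulDr : right_distributive (@tmul R M) +%R.
Proof.
move=> f g h; apply: tcoefP => k kM; rewrite raddfD /= !tcoef_mul_poly //.
by rewrite /= mulrDr coefD.
Qed.

Lemma tone_neq0 : tone != 0.
Proof.
apply/eqP => /(congr1 (tcoef 0)); rewrite raddf0 /tcoef coef_npolyp coef1 /=.
by move/eqP; rewrite oner_eq0.
Qed.

HB.instance Definition _ := GRing.Zmodule_isNzRing.Build T
  tmulA tmul1f tmulf1 tmulDl tmulDr tone_neq0.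

Lemma tcoefM k f g : (k <= M)%N ->
  tcoef k (f * g) = \sum_(i < k.+1) tcoef i f * tcoef (k - i) g.
Proof. by move=> kM; rewrite tcoef_mul_poly // coefM. Qed.

Lemma tcoef1 k : tcoef k (1 : T) = (k == 0%N)%:R.
Proof. by rewrite /tcoef npolypK ?size_poly1 // coef1. Qed.


Lemma tcoef_const k (c : R) : tcoef k (tconst M c) = if k == 0%N then c else 0.
Proof.
have [kM|Mk] := leqP k M; first by rewrite tconst.unlock tcoef_make.
by rewrite tcoef_gt //; case: k Mk.
Qed.

Lemma tcoef_constM k (c : R) f : tcoef k (tconst M c * f) = c * tcoef k f.
Proof.
have [kM|Mk] := leqP k M; last by rewrite !tcoef_gt ?mulr0.
rewrite tcoefM // big_ord_recl big1 => [|i _]; last first.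
  by rewrite tcoef_const /= mul0r.
by rewrite tcoef_const /= subn0 addr0.
Qed.

Lemma tcoef_Mconst k (c : R) f : tcoef k (f * tconst M c) = tcoef k f * c.
Proof.
have [kM|Mk] := leqP k M; last by rewrite !tcoef_gt ?mul0r.
rewrite tcoefM // big_ord_recr big1 /= => [|i _]; last first.
  by rewrite tcoef_const subn_eq0 leqNgt ltn_ord mulr0.
by rewrite tcoef_const subnn eqxx add0r.
Qed.

Lemma tconst_is_additive : zmod_morphism (@tconst R M).
Proof.
by move=> c d; apply: tcoefP => -[|k] _; rewrite raddfB /= !tcoef_const ?subr0.
Qed.

Lemma tconst_is_monoid : monoid_morphism (@tconst R M).
Proof.
split=> [|c d]; apply: tcoefP => k _.
  by rewrite tcoef1 tcoef_const; case: k.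
by rewrite tcoef_constM !tcoef_const; case: k => //=; rewrite mulr0.
Qed.

HB.instance Definition _ :=
  GRing.isZmodMorphism.Build R T (@tconst R M) tconst_is_additive.
HB.instance Definition _ :=
  GRing.isMonoidMorphism.Build R T (@tconst R M) tconst_is_monoid.


Lemma tcoef_XM k f : (k < M)%N -> tcoef k.+1 (tX R M * f) = tcoef k f.
Proof.
move=> kM; rewrite tX.unlock tcoefM // big_ord_recl big_ord_recl.
rewrite big1 => [|i _]; last first.
  have [iM|Mi] := leqP (bump 0 (bump 0 i)) M; last by rewrite tcoef_gt ?mul0r.
  by rewrite tcoef_make ?mul0r.
rewrite tcoef_make //= mul0r add0r addr0 tcoef_make ?mul1r ?subSS ?subn0 //.
exact: leq_trans kM.
Qed.

Lemma tcoef0_XM f : tcoef 0 (tX R M * f) = 0.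
Proof. by rewrite tX.unlock tcoefM // big_ord1 tcoef_make // mul0r. Qed.

Lemma tX_comm f : f * tX R M = tX R M * f.
Proof.
apply: tcoefP => k kM; rewrite tX.unlock !tcoefM // (reindex_inj rev_ord_inj) /=.
apply: eq_bigr => i _; rewrite !subSS subKn -1?ltnS // tcoef_make; last first.
  by rewrite (leq_trans _ kM) // -ltnS.
by rewrite [RHS]mulr_natl mulr_natr.
Qed.

Lemma tcoef_euler k f : tcoef k (teuler f) = tcoef k f *+ k.
Proof.
have [kM|Mk] := leqP k M; last by rewrite !tcoef_gt ?mul0rn.
by rewrite teuler.unlock tcoef_make.
Qed.

Lemma teuler_is_additive : zmod_morphism (@teuler R M).
Proof.
by move=> f g; apply: tcoefP => k _; rewrite raddfB /= !tcoef_euler raddfB mulrnBl.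
Qed.

HB.instance Definition _ :=
  GRing.isZmodMorphism.Build T T (@teuler R M) teuler_is_additive.

Lemma tX_CA f g : f * (tX R M * g) = tX R M * (f * g).
Proof. by rewrite mulrA tX_comm mulrA. Qed.

Lemma teulerM f g : teuler (f * g) = teuler f * g + f * teuler g.
Proof.
apply: tcoefP => k kM; rewrite raddfD /= tcoef_euler !tcoefM // -sumrMnl.
rewrite -big_split; apply: eq_bigr => i _ /=.
by rewrite !tcoef_euler mulrnAl mulrnAr -mulrnDr subnKC // -ltnS.
Qed.

Lemma teuler_const (c : R) : teuler (tconst M c) = 0.
Proof.
apply: tcoefP => k _; rewrite tcoef_euler tcoef_const raddf0.
by case: k => [|k]; rewrite ?mulr0n ?mul0rn.
Qed.

(** The series [f] is divisible by t^j. *)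
Definition tord (j : nat) f := forall k, (k < j)%N -> tcoef k f = 0.

Lemma tordM i j f g : tord i f -> tord j g -> tord (i + j) (f * g).
Proof.
move=> fi gj k kij.
have [kM|Mk] := leqP k M; last by rewrite tcoef_gt.
rewrite tcoefM // big1 // => l _.
have [li|il] := ltnP l i; first by rewrite fi ?mul0r.
rewrite gj ?mulr0 // ltn_subLR; last by rewrite -ltnS.
by rewrite (leq_trans kij) // leq_add2r.
Qed.

Lemma tordX j f : tord 1 f -> tord j (f ^+ j).
Proof.
move=> f1; elim: j => [//|j IH]; rewrite exprS -[j.+1]add1n; exact: tordM.
Qed.

Lemma tord_eq0 f : tord M.+1 f -> f = 0.
Proof. by move=> f0; apply: tcoefP => k kM; rewrite f0 // raddf0. Qed.

Lemma tord_euler f : tord 1 (teuler f).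
Proof. by move=> [|//] _; rewrite tcoef_euler mulr0n. Qed.

End TruncatedSeries.

(** * Powers and exponentials of truncated series *)

Section Powers.
Variables (R : nzRingType) (M : nat).
Local Notation T := (tseries R M).
Implicit Types f g h : T.

Lemma tcoefX k s : (k <= M)%N -> tcoef k (tX R M ^+ s) = (k == s)%:R.
Proof.
elim: s k => [|s IHs] k kM; first by rewrite expr0 tcoef1.
rewrite exprS; case: k kM => [|k] kM; first by rewrite tcoef0_XM.
by rewrite tcoef_XM // IHs // ltnW.
Qed.

Lemma tseries_expand f : f = \sum_(i < M.+1) tconst M (tcoef i f) * tX R M ^+ i.
Proof.
apply: tcoefP => k kM; rewrite raddf_sum (bigD1 (Ordinal (kM : (k < M.+1)%N))) //=.
rewrite tcoef_constM tcoefX // eqxx mulr1 big1 ?addr0 // => i.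
by rewrite -val_eqE eq_sym tcoef_constM tcoefX //= => /negPf ->; rewrite mulr0.
Qed.

Lemma tX_commX f s : f * tX R M ^+ s = tX R M ^+ s * f.
Proof. exact: (commrX s (tX_comm f)). Qed.

Lemma prod_monomials (j : nat) (a : 'I_j -> R) (s : 'I_j -> nat) :
  \prod_(i < j) (tconst M (a i) * tX R M ^+ s i) =
  tconst M (\prod_(i < j) a i) * tX R M ^+ (\sum_(i < j) s i)%N.
Proof.
elim/big_rec3: _ => [|i n x y _ ->]; first by rewrite rmorph1 mul1r expr0.
by rewrite exprD rmorphM /= -!mulrA; congr (_ * _); rewrite mulrA -tX_commX -mulrA.
Qed.

(** Expansion of a power as a sum over compositions; factors of degree 0 are
    still allowed here. *)
Lemma tcoef_expr f j k : (k <= M)%N ->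
  tcoef k (f ^+ j) = \sum_(l : j.-tuple 'I_M.+1 |
    (\sum_(i < j) tnth l i == k)%N) \prod_(i < j) tcoef (tnth l i) f.
Proof.
move=> kM; rewrite {1}(tseries_expand f) -[j in LHS]card_ord -prodr_const.
rewrite bigA_distr_bigA raddf_sum /= [RHS]big_mkcond /=.
rewrite (reindex (fun l : j.-tuple 'I_M.+1 => [ffun i => tnth l i])) /=; last first.
  exists (fun g : {ffun 'I_j -> 'I_M.+1} => [tuple g i | i < j]) => [l _|g _].
    by apply: eq_from_tnth => i; rewrite tnth_mktuple ffunE.
  by apply/ffunP => i; rewrite ffunE tnth_mktuple.
apply: eq_bigr => l _; under eq_bigr => i _ do rewrite ffunE.
rewrite prod_monomials tcoef_constM tcoefX // eq_sym.
by case: ifP => _; rewrite ?mulr1 ?mulr0.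
Qed.
End Powers.

(** The truncation of exp (t A). *)
HB.lock Definition texp (K : numFieldType) (R : algType K) (M : nat) (A : R) :
    tseries R M :=
  tmake M (fun k => (k`!%:R^-1 : K) *: A ^+ k).

Arguments texp {K R}.

Section Exponential.
Variables (K : numFieldType) (R : algType K) (M : nat).
Local Notation T := (tseries R M).
Local Notation t := (tX R M).
Local Notation "c %:S" := (tconst M c) (at level 2, format "c %:S").
Implicit Types (A C : R) (f : T).

Lemma mulrn_scale A n : A *+ n = (n%:R : K) *: A.
Proof. by rewrite scaler_nat. Qed.

(** In characteristic 0 only the constants are killed by t d/dt. *)
Lemma teuler_eq0 f : teuler f = 0 -> f = (tcoef 0 f)%:S.
Proof.
move=> f0; apply: tcoefP => -[|k] kM; rewrite tcoef_const //=.
have /eqP := congr1 (tcoef k.+1) f0; rewrite tcoef_euler raddf0.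
by rewrite mulrn_scale scaler_eq0 pnatr_eq0 /= => /eqP.
Qed.

Lemma tcoef_exp k A : (k <= M)%N -> tcoef k (texp M A) = (k`!%:R^-1 : K) *: A ^+ k.
Proof. by rewrite texp.unlock; exact: tcoef_make. Qed.

Lemma tcoef0_exp A : tcoef 0 (texp M A) = 1.
Proof. by rewrite tcoef_exp // fact0 invr1 scale1r. Qed.

Lemma teuler_exp A : teuler (texp M A) = t * (A%:S * texp M A).
Proof.
apply: tcoefP => -[|k] kM; rewrite tcoef_euler ?tcoef0_XM // tcoef_XM //.
rewrite tcoef_constM !tcoef_exp ?(ltnW kM) // -scalerAr -exprS.
rewrite mulrn_scale scalerA; congr (_ *: _).
by rewrite factS natrM invfM mulrA mulfV ?mul1r // pnatr_eq0.
Qed.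

Lemma texp_comm A C : C * A = A * C -> C%:S * texp M A = texp M A * C%:S.
Proof.
move=> CA; apply: tcoefP => k kM; rewrite tcoef_constM tcoef_Mconst tcoef_exp //.
by rewrite -scalerAr -scalerAl (commrX k CA).
Qed.

(** The derivative of exp (- t A) exp (t A) vanishes, and its constant term
    is 1. *)
Lemma texpNM A : texp M (- A) * texp M A = 1.
Proof.
rewrite [LHS]teuler_eq0 ?tcoefM //.
  by rewrite big_ord1 !tcoef0_exp mulr1 rmorph1.
have cA : A%:S * texp M (- A) = texp M (- A) * A%:S.
  by apply: texp_comm; rewrite mulrN mulNr.
by rewrite teulerM !teuler_exp rmorphN /= !(mulNr, mulrN) cA !mulrA tX_comm addNr.
Qed.

Lemma texpMN A : texp M A * texp M (- A) = 1.
Proof. by rewrite -{1}[A]opprK texpNM. Qed.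

Lemma texpMK A f : texp M A * (texp M (- A) * f) = f.
Proof. by rewrite mulrA texpMN mul1r. Qed.

Lemma texpNMK A f : texp M (- A) * (texp M A * f) = f.
Proof. by rewrite mulrA texpNM mul1r. Qed.
End Exponential.

(** * The algebra of banded matrices *)

Section BandedMatrices.
Variable K : numFieldType.

(** A finitely supported sum over the natural numbers is an ordinary sum. *)
Lemma fsum_natE (f : nat -> K) (n : nat) :
  (forall i, (n <= i)%N -> f i = 0) ->
  \sum_(i \in [set: nat]) f i = \sum_(i < n) f i.
Proof.
move=> f0; rewrite fsbig_ord; apply/esym/fsbig_widen => // i [_ /= /negP].
by rewrite -leqNgt; apply: f0.
Qed.

(** One-sided banded matrices as a predicate, so that they form a subtype. *)
Definition banded : {pred imatrix K} := fun A => `[< one_sided_banded A >].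

Lemma bandedP (A : imatrix K) : reflect (one_sided_banded A) (A \in banded).
Proof. exact: asboolP. Qed.

Lemma banded_zmod_closed : zmod_closed banded.
Proof.
split=> [|A B /bandedP[a a0 hA] /bandedP[b b0 hB]]; apply/bandedP.
  by exists 1%N.
exists (maxn a b) => [|i j ij]; first by rewrite leq_max a0.
rewrite -[LHS]/(A i j - B i j) hA ?hB ?subrr //.
  by apply: leq_ltn_trans ij; rewrite leq_add2l leq_maxr.
by apply: leq_ltn_trans ij; rewrite leq_add2l leq_maxl.
Qed.

HB.instance Definition _ :=
  GRing.isZmodClosed.Build (imatrix K) banded banded_zmod_closed.

(** The algebra of one-sided banded infinite matrices. Rows are finitely
    supported, so products are finite sums. *)
Record bmatrix := BMatrix {bmval :> imatrix K; _ : bmval \in banded}.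

HB.instance Definition _ := [isSub for bmval].
HB.instance Definition _ := [Choice of bmatrix by <:].
HB.instance Definition _ := [SubChoice_isSubZmodule of bmatrix by <:].

Implicit Types A B C : bmatrix.

Lemma bmatrixP A B : (forall i j, bmval A i j = bmval B i j) -> A = B.
Proof.
by move=> AB; apply: val_inj; apply/funext => i; apply/funext => j; apply: AB.
Qed.

Lemma bmatrix_bound A : exists2 b : nat, (0 < b)%N &
  forall i j : nat, (i + b < j)%N -> bmval A i j = 0.
Proof. by case: A => A hA; apply/bandedP. Qed.

Lemma bmDE A B i j : bmval (A + B) i j = bmval A i j + bmval B i j. Proof. by []. Qed.
Lemma bmNE A i j : bmval (- A) i j = - bmval A i j. Proof. by []. Qed.

Lemma imulmxE (A B : imatrix K) i j n :
  (forall k, (n <= k)%N -> A i k = 0) ->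
  imulmx A B i j = \sum_(k < n) A i k * B k j.
Proof. by move=> An; apply: fsum_natE => k nk; rewrite An ?mul0r. Qed.

Lemma banded_imulmx A B : imulmx A B \in banded.
Proof.
have [a a0 hA] := bmatrix_bound A; have [b b0 hB] := bmatrix_bound B.
apply/bandedP; exists (a + b)%N; first by rewrite addn_gt0 a0.
move=> i j ij; rewrite (@imulmxE _ _ _ _ (i + a).+1); last exact: hA.
rewrite big1 // => k _.
rewrite hB ?mulr0 //; apply: leq_ltn_trans ij; rewrite addnA leq_add2r.
by rewrite -ltnS.
Qed.

Definition bmul A B : bmatrix := BMatrix (banded_imulmx A B).

Lemma banded_iidmx : iidmx K \in banded.
Proof.
apply/bandedP; exists 1%N => // i j ij; rewrite /iidmx; case: eqVneq => // E.
by rewrite E ltnNge leq_addr in ij.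
Qed.

Definition bone : bmatrix := BMatrix banded_iidmx.

Lemma bmulA : associative bmul.
Proof.
move=> A B C; apply: bmatrixP => i j /=.
have [a a0 hA] := bmatrix_bound A; have [b b0 hB] := bmatrix_bound B.
pose n := (i + a).+1; pose N := (i + a + b).+1.
have hn k : (n <= k)%N -> bmval A i k = 0 by apply: hA.
rewrite (@imulmxE A _ _ _ n) //.
have hN k l : (k < n)%N -> (N <= l)%N -> bmval B k l = 0.
  by move=> kn Nl; apply: hB; apply: leq_ltn_trans Nl; rewrite leq_add2r -ltnS.
have hAB k : (N <= k)%N -> imulmx A B i k = 0.
  move=> Nk; rewrite (@imulmxE A _ _ _ n) // big1 // => l _.
  by rewrite (hN l k) ?mulr0.
rewrite [RHS](@imulmxE _ _ _ _ N) //.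
under eq_bigr => k _.
  rewrite (@imulmxE B _ _ _ N) => [|l Nl]; last exact: (hN k l).
  rewrite big_distrr /=; over.
rewrite exchange_big; apply: eq_bigr => l _ /=.
rewrite (@imulmxE A _ _ _ n) // big_distrl; apply: eq_bigr => k _ /=.
by rewrite mulrA.
Qed.

Lemma bmul1 : left_id bone bmul.
Proof.
move=> A; apply: bmatrixP => i j /=.
rewrite (@imulmxE _ _ _ _ i.+1) => [|k ik]; last by rewrite /iidmx ltn_eqF.
rewrite big_ord_recr big1 /= => [|k _].
  by rewrite /iidmx eqxx mul1r add0r.
by rewrite /iidmx gtn_eqF ?mul0r.
Qed.

Lemma bmulr1 : right_id bone bmul.
Proof.
move=> A; apply: bmatrixP => i j /=.
have [a a0 hA] := bmatrix_bound A.
rewrite (@imulmxE _ _ _ _ (maxn (i + a).+1 j.+1)) => [|k]; last first.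
  by rewrite geq_max => /andP[/hA].
rewrite (bigD1 (Ordinal (leq_maxr (i + a).+1 j.+1))) //= big1 => [|k].
  by rewrite /iidmx eqxx mulr1 addr0.
by rewrite -val_eqE /= => /negPf kj; rewrite /iidmx kj mulr0.
Qed.

Lemma bmulDl : left_distributive bmul +%R.
Proof.
move=> A B C; apply: bmatrixP => i j; rewrite bmDE /=.
have [a a0 hA] := bmatrix_bound A; have [b b0 hB] := bmatrix_bound B.
have hAn k : (maxn (i + a).+1 (i + b).+1 <= k)%N -> bmval A i k = 0.
  by rewrite geq_max => /andP[/hA].
have hBn k : (maxn (i + a).+1 (i + b).+1 <= k)%N -> bmval B i k = 0.
  by rewrite geq_max => /andP[_ /hB].
rewrite [RHS](f_equal2 _ (imulmxE _ _ hAn) (imulmxE _ _ hBn)) -big_split /=.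
rewrite (@imulmxE _ _ _ _ (maxn (i + a).+1 (i + b).+1)) => [|k ik].
  by apply: eq_bigr => k _; rewrite -mulrDl.
by rewrite -[LHS]/(bmval A i k + bmval B i k) hAn ?hBn ?addr0.
Qed.

Lemma bmulDr : right_distributive bmul +%R.
Proof.
move=> A B C; apply: bmatrixP => i j; rewrite bmDE /=.
have [a a0 hA] := bmatrix_bound A.
rewrite !(imulmxE _ _ (hA i)) -big_split /=.
by apply: eq_bigr => k _; rewrite -mulrDr.
Qed.

Lemma bone_neq0 : bone != 0.
Proof.
apply/eqP => /(congr1 (fun A : bmatrix => bmval A 0%N 0%N)) /eqP.
by rewrite /= /iidmx eqxx oner_eq0.
Qed.

HB.instance Definition _ := GRing.Zmodule_isNzRing.Build bmatrix
  bmulA bmul1 bmulr1 bmulDl bmulDr bone_neq0.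

Lemma banded_scale (c : K) A : (fun i j => c * bmval A i j) \in banded.
Proof.
have [a a0 hA] := bmatrix_bound A; apply/bandedP; exists a => // i j ij.
by rewrite hA // mulr0.
Qed.

Definition bscale c A : bmatrix := BMatrix (banded_scale c A).

Lemma bscaleA a b A : bscale a (bscale b A) = bscale (a * b) A.
Proof. by apply: bmatrixP => i j; rewrite /= mulrA. Qed.
Lemma bscale1 : left_id 1 bscale.
Proof. by move=> A; apply: bmatrixP => i j; rewrite /= mul1r. Qed.
Lemma bscaleDr : right_distributive bscale +%R.
Proof. by move=> c A B; apply: bmatrixP => i j; exact: mulrDr. Qed.
Lemma bscaleDl A : {morph bscale^~ A : a b / a + b}.
Proof. by move=> a b; apply: bmatrixP => i j; exact: mulrDl. Qed.

HB.instance Definition _ := GRing.Zmodule_isLmodule.Build K bmatrix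
  bscaleA bscale1 bscaleDr bscaleDl.

Lemma bmME A B i j n : (forall k, (n <= k)%N -> bmval A i k = 0) ->
  bmval (A * B) i j = \sum_(k < n) bmval A i k * bmval B k j.
Proof. exact: imulmxE. Qed.

Lemma bmZE c A i j : bmval (c *: A) i j = c * bmval A i j. Proof. by []. Qed.

Lemma bscaleAl (c : K) A B : c *: (A * B) = c *: A * B.
Proof.
apply: bmatrixP => i j; have [a a0 hA] := bmatrix_bound A.
have hcA k : (i + a < k)%N -> bmval (c *: A) i k = 0.
  by move=> /hA; rewrite bmZE => ->; rewrite mulr0.
rewrite bmZE (bmME _ _ (hA i)) (bmME _ _ hcA) big_distrr.
by apply: eq_bigr => k _; exact: mulrA.
Qed.

HB.instance Definition _ := GRing.Lmodule_isLalgebra.Build K bmatrix bscaleAl.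

Lemma bscaleAr (c : K) A B : c *: (A * B) = A * (c *: B).
Proof.
apply: bmatrixP => i j; have [a a0 hA] := bmatrix_bound A.
rewrite bmZE !(bmME _ _ (hA i)) big_distrr.
by apply: eq_bigr => k _; rewrite bmZE mulrCA.
Qed.

HB.instance Definition _ := GRing.Lalgebra_isAlgebra.Build K bmatrix bscaleAr.
End BandedMatrices.

(** * Traces of matrices with finitely many nonzero columns *)

Section Trace.
Variable K : numFieldType.
Implicit Types A B C X : bmatrix K.

Lemma bmMnE A n : A *+ n = n%:R *: A.
Proof. by rewrite scaler_nat. Qed.

(** Matrices with finitely many nonzero columns. *)
Definition fincol X : Prop :=
  exists r, forall i j, (r <= j)%N -> bmval X i j = 0.

Lemma fincol0 : fincol 0.
Proof. by exists 0%N. Qed.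

Lemma fincolD X Y : fincol X -> fincol Y -> fincol (X + Y).
Proof.
move=> [r hX] [s hY]; exists (maxn r s) => i j; rewrite geq_max => /andP[rj sj].
by rewrite bmDE hX // hY // addr0.
Qed.

Lemma fincolN X : fincol X -> fincol (- X).
Proof. by move=> [r hX]; exists r => i j rj; rewrite bmNE hX // oppr0. Qed.

Lemma fincolZ (c : K) X : fincol X -> fincol (c *: X).
Proof. by move=> [r hX]; exists r => i j rj; rewrite bmZE hX // mulr0. Qed.

Lemma fincolMl A X : fincol X -> fincol (A * X).
Proof.
move=> [r hX]; exists r => i j rj; have [a a0 hA] := bmatrix_bound A.
by rewrite (bmME _ _ (hA i)) big1 // => k _; rewrite hX // mulr0.
Qed.

(** The rows of [A] with index less than [r] vanish outside the first r + a
    columns, where [a] is the band width of [A]. *)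
Lemma fincolMr A X : fincol X -> fincol (X * A).
Proof.
move=> [r hX]; have [a a0 hA] := bmatrix_bound A.
exists (r + a)%N => i j raj; rewrite (bmME _ _ (hX i)) big1 // => k _.
by rewrite hA ?mulr0 // (leq_trans _ raj) // ltn_add2r.
Qed.

Lemma fincol_sum (I : Type) (s : seq I) (P : pred I) (F : I -> bmatrix K) :
  (forall i, P i -> fincol (F i)) -> fincol (\sum_(i <- s | P i) F i).
Proof. by move=> hF; apply: big_ind => //; [exact: fincol0 | exact: fincolD]. Qed.

Lemma banded_projP n : projP K n \in @banded K.
Proof.
apply/bandedP; exists 1%N => // i j ij; rewrite /projP; case: eqVneq => // E.
by rewrite E ltnNge leq_addr in ij.
Qed.

(** The projection P_n as a banded matrix. *)
Definition bproj n : bmatrix K := BMatrix (banded_projP n).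

Lemma bmM_proj A n i j :
  bmval (A * bproj n) i j = if (j < n)%N then bmval A i j else 0.
Proof.
have [a a0 hA] := bmatrix_bound A.
rewrite (@bmME _ _ _ _ _ (maxn (i + a).+1 j.+1)) => [|k]; last first.
  by rewrite geq_max => /andP[/hA].
rewrite (bigD1 (Ordinal (leq_maxr (i + a).+1 j.+1))) //= big1 => [|k].
  by rewrite /projP eqxx addr0 /=; case: ifP; rewrite ?mulr1 ?mulr0.
by rewrite -val_eqE /= => /negPf kj; rewrite /projP kj mulr0.
Qed.

Lemma bproj_Mm A n i j :
  bmval (bproj n * A) i j = if (i < n)%N then bmval A i j else 0.
Proof.
rewrite (@bmME _ _ _ _ _ i.+1) => [|k ik]; last by rewrite /= /projP ltn_eqF.
rewrite big_ord_recr big1 /= => [|k _]; last by rewrite /projP gtn_eqF ?mul0r.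
by rewrite /projP eqxx add0r /=; case: ifP; rewrite ?mul1r ?mul0r.
Qed.

Lemma fincol_proj n : fincol (bproj n).
Proof.
exists n => i j nj; rewrite /= /projP.
by case: eqVneq => // ->; rewrite ltnNge nj.
Qed.

Lemma bproj_idem n : bproj n * bproj n = bproj n.
Proof.
apply: bmatrixP => i j; rewrite bmM_proj /= /projP.
by case: eqVneq => [->|_] /=; case: ltnP.
Qed.

Lemma fincolP X : fincol X <->
  exists r, forall n, (r <= n)%N -> X * bproj n = X.
Proof.
split; case=> r hX; exists r.
  move=> n rn; apply: bmatrixP => i j; rewrite bmM_proj.
  by case: ltnP => // nj; rewrite hX // (leq_trans rn).
by move=> i j rj; rewrite -(hX r) // bmM_proj ltnNge rj.
Qed.

(** The trace; it is additive and cyclic on matrices satisfying [fincol]. *)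
Definition btr A : K := itrace (bmval A).

Lemma btrE A n : (forall i, (n <= i)%N -> bmval A i i = 0) ->
  btr A = \sum_(i < n) bmval A i i.
Proof. exact: fsum_natE. Qed.

Lemma btr0 : btr 0 = 0.
Proof. by rewrite (@btrE _ 0) // big_ord0. Qed.

Lemma btrD X Y : fincol X -> fincol Y -> btr (X + Y) = btr X + btr Y.
Proof.
move=> [r hX] [s hY].
rewrite !(@btrE _ (maxn r s)) => [|i|i|i]; first by rewrite -big_split.
- by rewrite geq_max => /andP[_ si]; rewrite hY.
- by rewrite geq_max => /andP[ri _]; rewrite hX.
by rewrite geq_max => /andP[ri si]; rewrite bmDE hX // hY // addr0.
Qed.

Lemma btrZ c X : fincol X -> btr (c *: X) = c * btr X.
Proof.
move=> [r hX]; rewrite !(@btrE _ r) => [|i ri|i ri]; last 2 first.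
- by rewrite hX.
- by rewrite bmZE hX // mulr0.
by rewrite big_distrr.
Qed.

Lemma btr_sum (I : Type) (s : seq I) (P : pred I) (F : I -> bmatrix K) :
  (forall i, P i -> fincol (F i)) ->
  btr (\sum_(i <- s | P i) F i) = \sum_(i <- s | P i) btr (F i).
Proof.
move=> hF.
apply: (proj2 (big_rec2 (fun X c => fincol X /\ btr X = c) _ _)).
  by split; [exact: fincol0 | exact: btr0].
move=> i c X Pi [hX <-].
by split; [apply: fincolD => //; exact: hF | rewrite btrD //; exact: hF].
Qed.

(** Cyclicity of the trace. Both sides are the same finite double sum. *)
Lemma btrC X A : fincol X -> btr (X * A) = btr (A * X).
Proof.
move=> [r hX]; have [a a0 hA] := bmatrix_bound A.
have hXA i : (r + a <= i)%N -> bmval (X * A) i i = 0.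
  move=> rai; rewrite (bmME _ _ (hX i)) big1 // => k _.
  by rewrite hA ?mulr0 // (leq_trans _ rai) // ltn_add2r.
have hAX i : (r <= i)%N -> bmval (A * X) i i = 0.
  by move=> ri; rewrite (bmME _ _ (hA i)) big1 // => k _; rewrite hX // mulr0.
rewrite (btrE hXA) (btrE hAX).
under eq_bigr => i _ do rewrite (bmME _ _ (hX i)).
rewrite exchange_big; apply: eq_bigr => k _ /=.
rewrite (@imulmxE _ A X _ _ (r + a)) => [|l ral]; last first.
  by rewrite hA // (leq_trans _ ral) // ltn_add2r.
by apply: eq_bigr => l _; rewrite mulrC.
Qed.

Variable M : nat.
Local Notation T := (tseries (bmatrix K) M).
Implicit Types f g h : T.

(** Series all of whose coefficients have finitely many nonzero columns. *)
Definition tfin f : Prop := forall k, fincol (tcoef k f).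
(** The coefficient of t^k in the trace of a series. *)
Definition ttr k f : K := btr (tcoef k f).

Lemma tfinMl f g : tfin g -> tfin (f * g).
Proof.
move=> hg k; have [kM|Mk] := leqP k M; last by rewrite tcoef_gt //; exact: fincol0.
by rewrite tcoefM //; apply: fincol_sum => i _; apply: fincolMl (hg _).
Qed.

Lemma tfinMr f g : tfin f -> tfin (f * g).
Proof.
move=> hg k; have [kM|Mk] := leqP k M; last by rewrite tcoef_gt //; exact: fincol0.
by rewrite tcoefM //; apply: fincol_sum => i _; apply: fincolMr (hg _).
Qed.

Lemma tfin_const X : fincol X -> tfin (tconst M X).
Proof. by move=> hX k; rewrite tcoef_const; case: ifP => _ //; exact: fincol0. Qed.

Lemma ttrD k f g : tfin f -> tfin g -> ttr k (f + g) = ttr k f + ttr k g.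
Proof. by move=> hf hg; rewrite /ttr raddfD btrD //; [exact: hf | exact: hg]. Qed.

Lemma ttr_sum k (I : Type) (s : seq I) (P : pred I) (F : I -> T) :
  (forall i, P i -> tfin (F i)) ->
  ttr k (\sum_(i <- s | P i) F i) = \sum_(i <- s | P i) ttr k (F i).
Proof. by move=> hF; rewrite /ttr raddf_sum btr_sum // => i /hF; apply. Qed.

Lemma ttrC k f g : tfin f -> ttr k (f * g) = ttr k (g * f).
Proof.
move=> hf; have [kM|Mk] := leqP k M; last by rewrite /ttr !tcoef_gt.
rewrite /ttr !tcoefM // !btr_sum => [|i _|i _]; last 2 first.
- exact: fincolMl (hf _).
- exact: fincolMr (hf _).
rewrite (reindex_inj rev_ord_inj) /=; apply: eq_bigr => i _.
have ik : (i <= k)%N by rewrite -ltnS.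
rewrite subSS (subKn ik); apply: btrC; exact: hf.
Qed.

Lemma tfin_euler f : fincol (tcoef 0 f) -> tfin (teuler f) -> tfin f.
Proof.
move=> f0 hf [//|k].
suff -> : tcoef k.+1 f = (k.+1%:R^-1 : K) *: tcoef k.+1 (teuler f).
  exact: fincolZ (hf _).
by rewrite tcoef_euler bmMnE scalerA mulVf ?scale1r ?pnatr_eq0.
Qed.

Lemma ttr_euler k f : tfin f -> ttr k (teuler f) = k%:R * ttr k f.
Proof. by move=> hf; rewrite /ttr tcoef_euler bmMnE btrZ //; exact: hf. Qed.

(** A truncated series has finitely many coefficients, so one projection
    fixes them all. *)
Lemma tfin_bound f : tfin f ->
  exists r, forall n, (r <= n)%N -> f * tconst M (bproj n) = f.
Proof.
move=> hf.
have {hf}hf k : exists r, forall n, (r <= n)%N -> tcoef k f * bproj n = tcoef k f.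
  exact/fincolP.
have [r hr] := boolp.choice hf; exists (\max_(k < M.+1) r k) => n rn.
apply: tcoefP => k kM; rewrite tcoef_Mconst hr // (leq_trans _ rn) //.
by rewrite (leq_bigmax (Ordinal (kM : (k < M.+1)%N))).
Qed.
End Trace.

(** * Traces of logarithms and block triangular series *)

Section LogTrace.
Variables (K : numFieldType) (m : nat).
Local Notation T := (tseries (bmatrix K) m).
Implicit Types f g X P H : T.

Lemma tfin_teuler f : tfin f -> tfin (teuler f).
Proof. by move=> hf k; rewrite tcoef_euler bmMnE; apply: fincolZ. Qed.

Lemma ttrN k f : tfin f -> ttr k (- f) = - ttr k f.
Proof. by move=> hf; rewrite /ttr raddfN -scaleN1r btrZ ?mulN1r //; exact: hf. Qed.

Lemma ttr_sign k i f : tfin f -> ttr k ((-1) ^+ i * f) = (-1) ^+ i * ttr k f.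
Proof.
move=> hf; rewrite -signr_odd -[in RHS]signr_odd; case: odd.
  by rewrite !expr1 !mulN1r ttrN.
by rewrite !expr0 !mul1r.
Qed.

(** The trace of theta(X^j) is j times that of X^(j-1) theta(X). The extra
    factor [X ^+ i] makes the induction work. *)
Lemma ttr_eulerX k i j X : tfin X ->
  ttr k (X ^+ i * teuler (X ^+ j.+1)) = j.+1%:R * ttr k (X ^+ (i + j) * teuler X).
Proof.
move=> hX; have hdX := tfin_teuler hX.
elim: j i => [|j IHj] i; first by rewrite addn0 mul1r.
rewrite exprSr teulerM mulrDr ttrD; last 2 first.
- by rewrite mulrA; apply: tfinMl.
- by rewrite mulrA; apply: tfinMl.
rewrite !mulrA -exprD -(ttrC _ _ hX) mulrA -exprS IHj addSnnS.
by rewrite -[in RHS]natr1 mulrDl mul1r.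
Qed.

(** Logarithmic derivative of tr log (P + X) in top degree, where X has no
    constant term and H is a left inverse of P + X in the corner of P. *)
Lemma ttr_log P X H :
    X * P = X -> teuler P = 0 -> tord 1 X -> tfin X ->
    H * P = H -> H * (P + X) = P ->
  m%:R * (\sum_(i < m) (-1) ^+ i / i.+1%:R * ttr m (X ^+ i.+1)) =
    ttr m (H * teuler X).
Proof.
move=> XP dP X1 hX HP HX; have hdX := tfin_teuler hX.
have XE : teuler X * P = teuler X by rewrite -{2}XP teulerM dP mulr0 addr0.
pose S := \sum_(i < m) (- X) ^+ i.
(* The series (- X)^m is divisible by t^m and theta(X) by t. *)
have XmE : (- X) ^+ m * teuler X = 0.
  apply: tord_eq0; rewrite -addn1; apply: tordM; last exact: tord_euler.
  by apply: tordX => k /X1 Xk; rewrite raddfN /= Xk oppr0.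
have HS : P * S = H - H * (- X) ^+ m.
  rewrite -{1}HX mulrDr HP -{1}[H]mulr1 -mulrDr -mulrA.
  have -> : (1 + X) * S = 1 - (- X) ^+ m.
    by rewrite -[RHS]opprB subrX1 -mulNr opprB opprK.
  by rewrite mulrBr mulr1.
transitivity (ttr m (S * teuler X)); last first.
  rewrite -{1}XE mulrA [LHS]ttrC; last exact: tfinMl.
  by rewrite mulrA HS mulrBl -mulrA XmE mulr0 subr0.
rewrite mulr_suml ttr_sum => [|i _]; last exact: tfinMl.
rewrite mulr_sumr; apply: eq_bigr => i _.
rewrite [in RHS]exprNn -[in RHS]mulrA ttr_sign; last exact: tfinMl.
have := ttr_eulerX m 0 i hX; rewrite expr0 mul1r add0n ttr_euler; last first.
  by rewrite exprSr; apply: tfinMl.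
move=> E; rewrite mulrCA E mulrA; congr (_ * _).
by rewrite mulfVK // pnatr_eq0.
Qed.
End LogTrace.

Section Absorption.
Variable R : nzRingType.
Implicit Types P f g : R.

(** The relation P f = P f P says that f is block lower triangular with respect
    to P; the relation f P = P f P used further on is its upper triangular
    counterpart. Both are stable under products. *)
Lemma absorbrM P f g :
  P * f = P * f * P -> P * g = P * g * P -> P * (f * g) = P * (f * g) * P.
Proof. by move=> hf hg; rewrite [LHS]mulrA hf -mulrA hg !mulrA -hf. Qed.

Lemma absorbrX P f k : P * P = P -> P * f = P * f * P -> P * f ^+ k = P * f ^+ k * P.
Proof.
move=> PP hf; elim: k => [|k IHk]; first by rewrite expr0 !mulr1 PP.
by rewrite exprS; apply: absorbrM.
Qed.

Lemma absorblM P f g :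
  f * P = P * f * P -> g * P = P * g * P -> f * g * P = P * (f * g) * P.
Proof.
move=> hf hg; have hg' : P * (g * P) = g * P by rewrite mulrA -hg.
by rewrite -[LHS]mulrA -hg' mulrA hf -!mulrA hg'.
Qed.

Lemma absorblX P f k : P * P = P -> f * P = P * f * P -> f ^+ k * P = P * f ^+ k * P.
Proof.
move=> PP hf; elim: k => [|k IHk]; first by rewrite expr0 mulr1 mul1r PP.
by rewrite exprS; apply: absorblM.
Qed.
End Absorption.

Section ExponentialAbsorption.
Variables (K : numFieldType) (R : algType K) (M : nat).
Local Notation "c %:S" := (tconst M c) (at level 2, format "c %:S").
Implicit Types A P : R.

Lemma texp_absorbr P A : P * P = P -> P * A = P * A * P ->
  P%:S * texp M A = P%:S * texp M A * P%:S.
Proof.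
move=> PP hA; apply: tcoefP => k kM.
by rewrite tcoef_Mconst tcoef_constM tcoef_exp // -scalerAr -scalerAl -absorbrX.
Qed.

Lemma texp_absorbl P A : P * P = P -> A * P = P * A * P ->
  texp M A * P%:S = P%:S * texp M A * P%:S.
Proof.
move=> PP hA; apply: tcoefP => k kM.
rewrite !tcoef_Mconst tcoef_constM tcoef_exp //.
by rewrite -scalerAr -!scalerAl -absorblX.
Qed.
End ExponentialAbsorption.

(** * The stabilised trace *)

Section MainTrace.
Variables (K : numFieldType) (m : nat).
Local Notation T := (tseries (bmatrix K) m).
Local Notation t := (tX (bmatrix K) m).
Local Notation "c %:S" := (tconst m c) (at level 2, format "c %:S").

(** The series P_n (exp (t A) - 1) P_n. *)
Definition tcompr (n : nat) (A : bmatrix K) : T :=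
  (bproj K n)%:S * (texp m A - 1) * (bproj K n)%:S.

Variables A C : bmatrix K.
Hypothesis lowA : forall n, bproj K n * A = bproj K n * A * bproj K n.
Hypothesis upC : forall n, C * bproj K n = bproj K n * C * bproj K n.
Hypothesis finD : fincol (C * A - A * C).

Local Notation E := (texp m (A + C)).
Local Notation E' := (texp m (- (A + C))).
Local Notation L := (texp m A).
Local Notation L' := (texp m (- A)).
Local Notation U := (texp m C).
Local Notation U' := (texp m (- C)).

(** The conjugate exp (t C) A exp (- t C) of the lower triangular part. *)
Definition conjA : T := U * A%:S * U'.

Lemma teuler_conjA : teuler conjA = t * (U * ((C * A - A * C)%:S * U')).
Proof.
have cU : C%:S * U = U * C%:S by apply: texp_comm.
rewrite /conjA !teulerM teuler_const mulr0 addr0 !teuler_exp cU.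
rewrite -!mulrA !tX_CA -mulrDr -mulrDr rmorphN /= mulNr mulrN.
by rewrite rmorphB !rmorphM /= mulrBl !mulrA.
Qed.

(** The derivative of [conjA] involves A and C only through their commutator,
    and its constant term is A. *)
Lemma tfin_conjA : tfin (conjA - A%:S).
Proof.
apply: tfin_euler.
  rewrite raddfB /= tcoef_const /conjA tcoefM // big_ord1 tcoef_Mconst.
  by rewrite !tcoef0_exp mulr1 mul1r subrr; exact: fincol0.
rewrite raddfB /= teuler_const subr0 teuler_conjA.
by apply/tfinMl/tfinMl/tfinMr/tfin_const.
Qed.

(** By cyclicity the derivative of [conjA] has trace t tr (C A - A C), which
    only contributes in degree 1. *)
Lemma ttr_conjA k : (1 < k)%N -> ttr k (conjA - A%:S) = 0.
Proof.
move=> k1; have [km|mk] := leqP k m; last first.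
  by rewrite /ttr tcoef_gt // btr0.
have k0 : k%:R != 0 :> K by rewrite pnatr_eq0 -lt0n (ltn_trans _ k1).
apply: (mulfI k0); rewrite mulr0 -ttr_euler; last exact: tfin_conjA.
rewrite raddfB /= teuler_const subr0 teuler_conjA -tX_CA.
have hD : tfin (t * ((C * A - A * C)%:S * U')).
  by apply/tfinMl/tfinMr/tfin_const.
rewrite -[LHS]ttrC // -!mulrA texpNM mulr1.
rewrite /ttr; case: k k1 km {k0} => [//|k] k1 km.
by rewrite tcoef_XM // tcoef_const; case: k k1 {km} => // k _; rewrite btr0.
Qed.

(** The logarithmic derivative of exp (t (A + C)) exp (- t C) is t times
    [conjA]. *)
Lemma teuler_EU' : teuler (E * U') = t * (E * U' * conjA).
Proof.
have cE : (A + C)%:S * E = E * (A + C)%:S by apply: texp_comm.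
rewrite /conjA teulerM !teuler_exp cE -!mulrA !tX_CA -mulrDr -mulrDr.
by rewrite rmorphN /= mulNr texpNMK rmorphD mulrDl addrK.
Qed.

(** For large n the series exp (t (A + C)) exp (- t C) and its inverse are
    block lower triangular with respect to P_n, although the factor
    exp (- t C) is upper triangular. *)
Lemma absorb_EU' : exists r, forall n, (r <= n)%N ->
  (bproj K n)%:S * (E * U') = (bproj K n)%:S * (E * U') * (bproj K n)%:S /\
  (bproj K n)%:S * (U * E') = (bproj K n)%:S * (U * E') * (bproj K n)%:S.
Proof.
(* Y is 1 up to finitely many columns, so Y Q_n = Q_n for large n, and then
   also Y^-1 Q_n = Q_n. *)
pose Y := E * U' * L'; pose Y' := L * (U * E').
have YK : Y' * Y = 1.
  rewrite /Y /Y' !mulrA -(mulrA (L * U)) texpNM mulr1 -(mulrA L) texpMN mulr1.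
  exact: texpMN.
have finY : tfin (Y - 1).
  apply: tfin_euler.
    rewrite raddfB /= tcoef1 /Y !tcoefM // !big_ord1 tcoefM // !big_ord1.
    by rewrite !tcoef0_exp !mulr1 subrr; exact: fincol0.
  have -> : teuler (Y - 1) = t * (E * U' * ((conjA - A%:S) * L')).
    rewrite raddfB /= -(rmorph1 (tconst m)) teuler_const subr0 /Y teulerM.
    rewrite teuler_EU' teuler_exp rmorphN /= -!mulrA !tX_CA -!mulrDr.
    by rewrite mulrBl mulNr /conjA -!mulrA.
  by apply/tfinMl/tfinMl/tfinMr/tfin_conjA.
have [r hr] := tfin_bound finY; exists r => n /hr.
set P := (bproj K n)%:S => YP.
have PP : bproj K n * bproj K n = bproj K n by exact: bproj_idem.
have PPS : P * P = P by rewrite -rmorphM /= PP.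
have YQ : Y * (1 - P) = 1 - P.
  move: YP; rewrite mulrBl mul1r => YP; rewrite mulrBr mulr1.
  have -> : Y * P = Y - 1 + P by rewrite -YP subrK.
  by rewrite opprD opprB addrA [Y + _]addrC subrK.
have Y'Q : Y' * (1 - P) = 1 - P by rewrite -YQ mulrA YK mul1r.
have absQ Z : Z * (1 - P) = 1 - P -> P * Z = P * Z * P.
  move=> ZQ; apply/eqP; rewrite -subr_eq0 -{1}[P * Z]mulr1 -mulrBr -mulrA ZQ.
  by rewrite mulrBr mulr1 PPS subrr.
have hL : P * L = P * L * P by apply: texp_absorbr.
have hL' : P * L' = P * L' * P.
  by apply: texp_absorbr => //; rewrite mulrN mulNr -lowA.
split.
  have -> : E * U' = Y * L by rewrite /Y -mulrA texpNM mulr1.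
  by apply: absorbrM => //; exact: absQ.
have -> : U * E' = L' * Y' by rewrite /Y' mulrA texpNM mul1r.
by apply: absorbrM => //; exact: absQ.
Qed.

(** The coefficient of t^m in tr log (P_n exp (t (A + C)) P_n) vanishes for
    large n. The logarithmic series stops at the power m because the next
    powers of [tcompr n (A + C)] are 0. *)
Lemma ttr_compr_eventually0 : (2 < m)%N ->
  exists r, forall n, (r <= n)%N ->
    \sum_(i < m) (-1) ^+ i / i.+1%:R * ttr m (tcompr n (A + C) ^+ i.+1) = 0.
Proof.
move=> m2.
have [r1 hr1] := absorb_EU'; have [r2 hr2] := tfin_bound tfin_conjA.
exists (maxn r1 r2) => n; rewrite geq_max => /andP[/hr1[] + + /hr2 {hr1 hr2}].
rewrite /tcompr; set P := (bproj K n)%:S => hW hW' hV.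
have PP : bproj K n * bproj K n = bproj K n by exact: bproj_idem.
have PPS : P * P = P by rewrite -rmorphM /= PP.
have finP : tfin P by apply/tfin_const/fincol_proj.
have hU : U * P = P * U * P by apply: texp_absorbl.
have hU' : U' * P = P * U' * P.
  by apply: texp_absorbl => //; rewrite mulrN !mulNr -upC.
have hC : C%:S * P = P * C%:S * P by rewrite -!rmorphM /= -upC.
have cU : C%:S * U = U * C%:S by apply: texp_comm.
have dP : teuler P = 0 by exact: teuler_const.
set W := E * U' in hW; set W' := U * E' in hW'.
have W'W : W' * W = 1.
  by rewrite /W /W' !mulrA -(mulrA U) texpNM mulr1 texpMN.
have WU : W * U = E by rewrite /W -mulrA texpNM mulr1.
have dW : teuler W = t * (W * conjA) by exact: teuler_EU'.
clearbody W W'.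
pose X := P * (E - 1) * P; pose H := U' * P * W'.
(* Factorisation of the compressed exponential, and its left inverse H. *)
have GE : P + X = P * W * U * P.
  by rewrite /X mulrBr mulrBl mulr1 PPS addrC subrK -mulrA -(mulrA P) WU mulrA.
have HP : H * P = H by rewrite /H -[U' * P * W']mulrA -mulrA -hW'.
have HW : H * P * W = U' * P.
  by rewrite HP /H -mulrA W'W mulr1.
have HG : H * (P + X) = P.
  by rewrite GE !mulrA HW -(mulrA U') -(mulrA U') -hU mulrA texpNM mul1r.
have finX : tfin X by exact: tfinMl.
have ordX : tord 1 X.
  case=> // _; rewrite tcoef_Mconst tcoef_constM raddfB /= tcoef0_exp tcoef1.
  by rewrite subrr mulr0 mul0r.
have XP : X * P = X by rewrite /X -mulrA PPS.
have m0 : m%:R != 0 :> K by rewrite pnatr_eq0 -lt0n (ltn_trans _ m2).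
apply: (mulfI m0); rewrite mulr0 (ttr_log XP dP ordX finX HP HG).
(* From here on only [HW] is needed about H. *)
clearbody H.
have -> : H * teuler X = t * (U' * P * (conjA * U * P)) + t * (C%:S * P).
  have -> : teuler X = teuler (P + X) by rewrite raddfD /= dP add0r.
  rewrite GE !teulerM dP mul0r mulr0 add0r addr0 dW teuler_exp mulrDl.
  have hCU : C%:S * U * P = P * (C%:S * U) * P by exact: absorblM.
  rewrite -!mulrA !tX_CA -mulrDr !tX_CA -[RHS]mulrDr; congr (t * _).
  rewrite mulrDr !mulrA HW -!mulrA; congr (_ + _).
  by move: hCU; rewrite -!mulrA => <-; rewrite mulrA cU -mulrA texpNMK.
have finUP : tfin (U' * P) by exact: tfinMl.
have m_gt0 : (0 < m)%N by exact: ltn_trans m2.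
have m2' : (1 < m)%N by exact: ltn_trans m2.
have tXtop (f : T) : tcoef m (t * f) = tcoef m.-1 f.
  by rewrite -[X in tcoef X (t * f)](prednK m_gt0) tcoef_XM // prednK.
have tX_const c : ttr m (t * c%:S) = 0.
  by rewrite /ttr tXtop tcoef_const -[_ == _]leqn0 leqNgt -ltnS prednK // m2' btr0.
rewrite ttrD; [|exact/tfinMl/tfinMr|exact/tfinMl/tfinMl].
rewrite -[C%:S * P]rmorphM tX_const addr0 -tX_CA ttrC //.
have -> : t * (conjA * U * P) * (U' * P) =
  t * (conjA - A%:S) + t * (A * bproj K n)%:S.
  have -> V : t * (V * U * P) * (U' * P) = t * (V * P).
    by rewrite -!mulrA [P * (U' * P)]mulrA -hU' texpMK.
  by rewrite -mulrDr -hV rmorphM /= mulrBl subrK.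
rewrite ttrD; last 2 first.
- exact/tfinMl/tfin_conjA.
- exact/tfinMl/tfin_const/fincolMl/fincol_proj.
rewrite tX_const addr0 /ttr tXtop; apply: (@ttr_conjA m.-1).
by rewrite -ltnS prednK.
Qed.
End MainTrace.

(** * Cumulants as traces of powers *)

Section Cumulant.
Variables (K : numFieldType).
Implicit Types (B : bmatrix K) (s : seq nat).

Lemma iexpmxE B l : iexpmx (bmval B) l = bmval (B ^+ l).
Proof. by elim: l => [//|l IHl]; rewrite exprS /iexpmx iterS -/(iexpmx _ _) IHl. Qed.

Lemma compressed_productE n B s :
  compressed_product n (bmval B) s =
  bmval (bproj K n * \prod_(l <- s) (bproj K n * B ^+ l * bproj K n)).
Proof.
elim: s => [|l s IHs]; first by rewrite big_nil mulr1.
transitivity (imulmx (projP K n) (imulmx (iexpmx (bmval B) l)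
  (compressed_product n (bmval B) s))) => //.
rewrite IHs iexpmxE big_cons; set X := \prod_(l <- s) _.
transitivity (bmval (bproj K n * (B ^+ l * (bproj K n * X)))) => //.
by rewrite !mulrA bproj_idem.
Qed.

Lemma tcoef_tcompr m n B l : (l <= m)%N ->
  tcoef l (tcompr m n B) =
  if l == 0%N then 0 else (l`!%:R^-1 : K) *: (bproj K n * B ^+ l * bproj K n).
Proof.
move=> lm; rewrite /tcompr tcoef_Mconst tcoef_constM raddfB /= tcoef1 tcoef_exp //.
case: l lm => [|l] lm /=; first by rewrite fact0 invr1 scale1r subrr mulr0 mul0r.
by rewrite subr0 -scalerAr -scalerAl.
Qed.

(** Terms of the expansion with some l_i = 0 drop out, because the series
    [tcompr n B] has no constant term. *)
Lemma ttr_tcomprX m n B j : (0 < j)%N ->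
  ttr m (tcompr m n B ^+ j) =
  \sum_(l : j.-tuple 'I_m.+1 |
        (\sum_(i < j) tnth l i == m)%N && [forall i, (1 <= tnth l i)%N])
    itrace (compressed_product n (bmval B) (map val l)) /
      \prod_(i < j) (tnth l i)`!%:R.
Proof.
move=> j0; rewrite /ttr tcoef_expr // btr_sum => [|l _]; last first.
  case: j j0 l => // j _ l; rewrite big_ord_recl; apply: fincolMr.
  by apply/tfinMl/tfin_const/fincol_proj.
rewrite big_mkcondr /=; apply: eq_bigr => l _.
case: ifPn => [/forallP l1|/forallPn[i]]; last first.
  rewrite -eqn0Ngt => /eqP li.
  suff -> : \prod_(i < j) tcoef (tnth l i) (tcompr m n B) = 0 by rewrite btr0.
  have : tcoef (tnth l i) (tcompr m n B) = 0 by rewrite tcoef_tcompr li.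
  elim: (j) (tnth l) i {li} => [|k IHk] f i; first by case: i.
  rewrite big_ord_recl; case: (unliftP ord0 i) => [i' ->|->] fi.
    by rewrite (IHk (fun i => f (lift ord0 i)) i') ?mulr0.
  by rewrite fi mul0r.
under eq_bigr => i _.
  rewrite tcoef_tcompr; last by rewrite -ltnS.
  rewrite -[_ == _]negbK -lt0n l1 /=; over.
rewrite scaler_prod btrZ; last first.
  case: j j0 l l1 => // j _ l _; rewrite big_ord_recl; apply: fincolMr.
  by apply/fincolMl/fincol_proj.
rewrite prodfV mulrC compressed_productE /btr; congr (itrace _ / _).
rewrite big_map big_tuple; case: j j0 l {l1} => // j _ l.
by rewrite big_ord_recl !mulrA bproj_idem.
Qed.

Lemma cumulantE m n B :
  cumulant m n (bmval B) =
  m`!%:R * \sum_(i < m) (-1) ^+ i / i.+1%:R * ttr m (tcompr m n B ^+ i.+1).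
Proof.
rewrite /cumulant big_add1 big_mkord; congr (_ * _); apply: eq_bigr => i _.
by rewrite ttr_tcomprX // !exprS mulN1r mulN1r opprK.
Qed.
End Cumulant.

Theorem theorem3p3 (K : numFieldType) (B Bminus Bplus : imatrix K)
    (hB : one_sided_banded B)
    (hdec : B = Bminus + Bplus)
    (hminus : strictly_lower_triangular Bminus)
    (hplus : upper_triangular_banded Bplus)
    (hcomm : exists s : nat,
      imulmx (imulmx Bminus Bplus - imulmx Bplus Bminus) (projQ K s) = 0)
    (m : nat) (hm : (3 <= m)%N) :
  cumulant m n B @[n --> \oo] --> (0 : K).
Proof.
have bandA : Bminus \in @banded K.
  apply/bandedP; exists 1%N => // i j ij.
  by rewrite hminus // ltnW // (leq_ltn_trans _ ij) ?leq_addr.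
have bandC : Bplus \in @banded K.
  have [b hb] := hplus; apply/bandedP; exists b.+1 => // i j ij.
  by rewrite hb // (leq_ltn_trans _ ij) ?orbT // leq_add2l.
pose A := BMatrix bandA; pose C := BMatrix bandC.
have lowA n : bproj K n * A = bproj K n * A * bproj K n.
  apply: bmatrixP => i j; rewrite bmM_proj bproj_Mm.
  case: (ltnP j n) => // nj; case: ltnP => // ni.
  by apply: hminus; rewrite (leq_trans _ nj) // ltnW.
have upC n : C * bproj K n = bproj K n * C * bproj K n.
  apply: bmatrixP => i j; rewrite -mulrA bproj_Mm bmM_proj.
  case: (ltnP i n) => // ni; case: ltnP => // jn.
  have [b hb] := hplus; apply: hb.
  by rewrite (leq_trans jn ni).
have finD : fincol (C * A - A * C).
  rewrite -opprB; apply: fincolN.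
  have [s hs] := hcomm; exists s => i j sj.
  have /(congr1 (fun X : imatrix K => X i j)) := hs.
  have -> : imulmx (imulmx Bminus Bplus - imulmx Bplus Bminus) (projQ K s) =
    bmval ((A * C - C * A) * (1 - bproj K s)) by [].
  by rewrite mulrBr mulr1 bmDE bmNE bmM_proj ltnNge sj /= subr0.
have BE : B = bmval (A + C) by [].
have [r hr] := ttr_compr_eventually0 lowA upC finD hm.
apply: cvg_near_cst; exists r => // n /= rn.
by rewrite BE cumulantE hr // mulr0.
Qed.
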